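(* Let $G$ be a countable group, let $\mu$ be a non-degenerate probability measure on $G$, and let $\Omega$ be the set of all weights $\omega$ on $G$ such that $\mu$ has finite $\log\omega$-moment and $1/\omega\in\ell^1(G)$. Then the $\mu$-random walk has finite Avez entropy and \[ h(G,\mu)=\inf\{\mathrm{Ly}_\omega(G,\mu):\omega\in\Omega\}. \] Moreover, the infimum is attained at a weight $\bar\omega\in\Omega$ which also satisfies $\bar\omega^{-1}*\bar\omega^{-1}\le d\,\bar\omega^{-1}$ pointwise for some constant $d>0$; for this weight, $h(G,\mu)=\mathrm{Ly}_{\bar\omega}(G,\mu)$.
   Context: $\mu$ is non-degenerate if its support generates $G$ as a semigroup. A weight on $G$ is $\omega:G\to[a,\infty)$, $a>0$, with $\omega(st)\le C\omega(s)\omega(t)$ for some $C>0$ and all $s,t$. Finite $\log\omega$-moment: $\sum_s\mu(s)\log\omega(s)<\infty$. Convolution $f*g(s)=\sum_tf(t)g(t^{-1}s)$; $\mu^{*n}$ is the $n$-fold power. Shannon entropy $H(G,\mu)=-\sum_s\mu(s)\log\mu(s)$; Avez entropy $h(G,\mu)=\lim_n\frac1nH(G,\mu^{*n})$. Lyapunov exponent $\mathrm{Ly}_\omega(G,\mu)=\lim_n\frac1n\sum_s\mu^{*n}(s)\log\omega(s)$.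
   Formalization: The formal statement additionally assumes finite Shannon entropy H(G,μ)<∞; without it the claim fails, since H(G,μ)=∞ (possible e.g. on ℤ) forces infinite Avez entropy and makes Ω empty. *)

(* Defs.v *)
From mathcomp Require Import all_boot all_order all_algebra.
From mathcomp Require Import all_classical all_reals all_analysis.
Set Implicit Arguments. Unset Strict Implicit. Unset Printing Implicit Defensive.
Import Order.TTheory GRing.Theory Num.Theory.
Local Open Scope classical_set_scope.
Local Open Scope ring_scope.

Section Defs.
Context {R : realType} {G : groupType}.

(* sum over G of a nonnegative family, in [0, +oo] *)
Definition psum (u : G -> R) : \bar R := \esum_(s in [set: G]) (u s)%:E.

(* sum over G of a real family of arbitrary sign: sum of the positive parts
   minus sum of the negative parts (the usual meaning of a series that
   converges absolutely or diverges to +oo / -oo) *)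
Definition gsum (u : G -> R) : \bar R :=
  (\esum_(s in [set: G]) (Num.max (u s) 0)%:E - \esum_(s in [set: G]) (Num.max (- u s) 0)%:E)%E.

Definition prob_measure (mu : G -> R) : Prop :=
  (forall s, 0 <= mu s) /\ psum mu = 1%E.

Definition non_degenerate (mu : G -> R) : Prop :=
  forall g : G, exists l : seq G,
    [/\ (0 < size l)%N, all (fun s => 0 < mu s) l & g = (\prod_(s <- l) s)%g].

Definition weight (omega : G -> R) : Prop :=
  (exists a : R, 0 < a /\ forall s, a <= omega s) /\
  (exists C : R, 0 < C /\ forall s t, omega (s * t)%g <= C * omega s * omega t).

Definition econv (f g : G -> R) (s : G) : \bar R :=
  \esum_(t in [set: G]) (f t * g (t^-1 * s)%g)%:E.

(* real-valued convolution (finite for probability measures) *)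
Definition conv (f g : G -> R) (s : G) : R := fine (econv f g s).

Fixpoint convpow (mu : G -> R) (n : nat) : G -> R :=
  match n with
  | 0%N => fun s => if s == 1%g then 1 else 0
  | n.+1 => conv (convpow mu n) mu
  end.

(* Shannon entropy H(G, mu) = - sum_s mu(s) log mu(s)   (with 0 log 0 = 0) *)
Definition shannon (mu : G -> R) : \bar R := psum (fun s => - (mu s * ln (mu s))).

Definition avez_seq (mu : G -> R) (n : nat) : \bar R :=
  (((n%:R)^-1)%:E * shannon (convpow mu n))%E.
Definition avez (mu : G -> R) : \bar R := lim (avez_seq mu @ \oo).

Definition log_moment (mu omega : G -> R) : \bar R :=
  gsum (fun s => mu s * ln (omega s)).

Definition lyap (mu omega : G -> R) : \bar R :=
  lim ((fun n : nat => (((n%:R)^-1)%:E * log_moment (convpow mu n) omega)%E) @ \oo).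

Definition Omega (mu : G -> R) : set (G -> R) :=
  [set omega | [/\ weight omega, (log_moment mu omega < +oo)%E
                 & (psum (fun s => ((omega s)^-1)%R) < +oo)%E]].

End Defs.

(* Main.v *)
(** The [n]-step laws [mu^n] are mixed into [F = sum_n c_n mu^n] with
    [c_n = 1 / ((n + 1) (n + 2))], and the optimal weight is [1 / F]. As
    [c_m c_n <= 2 (c_m + c_n) c_(m + n)] and [sum_n c_n <= 1], one gets
    [F * F <= 4 F]; the term [F s F t] of [(F * F) (s t)] then shows that [1 / F]
    is submultiplicative up to the factor [4]. Since [F >= c_n mu^n], the
    [log (1 / F)]-moment of [mu^n] is at most [H (mu^n) - log c_n], and
    [log c_n = o(n)], so the Lyapunov exponent of [1 / F] is at most the Avez
    entropy. Conversely [- x log x <= x log w + 1 / w], summed over the group,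
    bounds [H (mu^n)] by the [log w]-moment of [mu^n] plus the [l^1]-norm of
    [1 / w], for every [w] in [Omega]. Both limits exist by Fekete's lemma. *)

Require Import Defs.
From mathcomp Require Import all_boot all_order all_algebra.
From mathcomp Require Import all_classical all_reals all_analysis.
From mathcomp Require Import ring lra.
Import Order.TTheory GRing.Theory Num.Theory.
Import numFieldNormedType.Exports.
Local Open Scope classical_set_scope.
Local Open Scope ring_scope.

(* MathComp-Analysis also has a [conv], for convex combinations. *)
Local Notation conv := Defs.conv.

(** * Unordered sums of nonnegative extended reals *)

Section Esum.
Context {R : realType}.
Implicit Types T U : choiceType.

Lemma esumZl T (r : R) (a : T -> \bar R) : 0 <= r -> (forall i, 0 <= a i)%E ->
  (\esum_(i in [set: T]) (r%:E * a i) = r%:E * \esum_(i in [set: T]) a i)%E.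
Proof.
move=> r0 a0; rewrite -ereal_supZl//; last first.
  by apply/set0P; exists 0%E; exists set0; [exact: fsets_set0|rewrite fsbig_set0].
congr ereal_sup; apply/seteqP; split=> x /=.
- by move=> [X XT <-]; exists (\sum_(i \in X) a i)%E; [exists X|rewrite ge0_mule_fsumr].
- by move=> [_ [X XT <-] <-]; exists X => //; rewrite ge0_mule_fsumr.
Qed.

Lemma esum_swap T U (a : T -> U -> \bar R) : (forall i j, 0 <= a i j)%E ->
  (\esum_(i in [set: T]) \esum_(j in [set: U]) a i j =
   \esum_(j in [set: U]) \esum_(i in [set: T]) a i j)%E.
Proof.
move=> a0; rewrite !esum_esum//.
rewrite (@reindex_esum R _ _ (setT `*`` fun=> setT) _ (fun x : U * T => (x.2, x.1)))//.
split => //=; first by move=> [? ?] [? ?] _ _ [-> ->].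
by move=> [i j] _; exists (j, i).
Qed.

Lemma esum_prod T U (a : T -> R) (b : U -> R) (x y : R) :
  (forall i, 0 <= a i) -> (forall j, 0 <= b j) ->
  x%:E = \esum_(i in [set: T]) (a i)%:E -> y%:E = \esum_(j in [set: U]) (b j)%:E ->
  (x * y)%:E =
    (\esum_(i in [set: T]) \esum_(j in [set: U]) (a i * b j)%:E)%E.
Proof.
move=> a0 b0 xE yE.
have y0 : 0 <= y by rewrite -lee_fin yE esum_ge0// => j _; rewrite lee_fin.
rewrite mulrC EFinM xE -esumZl//.
apply: eq_esum => i _; rewrite muleC yE -esumZl//.
Qed.

Lemma le_esum_term T (a : T -> \bar R) t : (forall i, 0 <= a i)%E ->
  (a t <= \esum_(i in [set: T]) a i)%E.
Proof.
by move=> a0; apply: esum_ge; exists [set t]; [split|rewrite fsbig_set1].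
Qed.

Lemma esum_single T (a : T -> \bar R) t : (0 <= a t)%E ->
  (forall i, i != t -> a i = 0%E) -> \esum_(i in [set: T]) a i = a t.
Proof.
move=> at0 ai; rewrite -(esum_set1 at0) [RHS]esum_mkcond; apply: eq_esum => i _.
case: ifPn => //; rewrite notin_setE/= => /eqP it; exact: ai.
Qed.

Lemma le_esum_inj T U (e : U -> T) (a : T -> \bar R) : injective e ->
  (forall i, 0 <= a i)%E ->
  (\esum_(i in [set: U]) a (e i) <= \esum_(i in [set: T]) a i)%E.
Proof.
move=> ei a0; rewrite -(@esum_image R U T setT e); last by move=> x y _ _ /ei.
by rewrite esum_mkcond; apply: le_esum => i _; case: ifP.
Qed.

Lemma reindex_esum_bij T U (e : U -> T) (a : T -> \bar R) : bijective e ->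
  (\esum_(i in [set: T]) a i = \esum_(i in [set: U]) a (e i))%E.
Proof. by move=> eb; apply: reindex_esum; rewrite setTT_bijective. Qed.

End Esum.

(** The limit is the infimum of the averages over [n >= 1]. A block length [m.+1] whose average
    nearly attains it controls every [n] by Euclidean division, up to a bounded term that vanishes
    after division by [n]. *)
Lemma fekete (R : realType) (u : R^nat) : (forall n, 0 <= u n) ->
  (forall m n, u (m + n)%N <= u m + u n) ->
  cvgn (fun n => n%:R^-1 * u n).
Proof.
move=> u0 uD.
(* The shift to [n.+1] leaves out [n = 0], where [0^-1 = 0] would put a spurious 0 in [E]. *)
pose E := [set n.+1%:R^-1 * u n.+1 | n in [set: nat]].
have E0 : has_lbound E.
  by exists 0 => _ [n _ <-]; rewrite mulr_ge0// invr_ge0.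
have hiE : has_inf E by split => //; exists (1%:R^-1 * u 1%N), 0%N.
apply/cvg_ex; exists (inf E); apply/cvgrPdist_le => e e0.
have [_ [m _ <-] me] := inf_adherent (divr_gt0 e0 (ltr0n R 2)) hiE.
(* [M] dominates [u 0 + u r] for every remainder [r]; [u 0], possibly positive, comes from the base
   case of [uq]. *)
pose M := u 0%N + \sum_(r < m.+1) u r.
have uq q : u (q * m.+1)%N <= q%:R * u m.+1 + u 0%N.
  elim: q => [|q IH]; first by rewrite mul0n mul0r add0r.
  by rewrite mulSn (le_trans (uD _ _))// -natr1 mulrDl mul1r addrAC addrC lerD2l.
have uM n : u n <= n%:R * (m.+1%:R^-1 * u m.+1) + M.
  rewrite {1}(divn_eq n m.+1) (le_trans (uD _ _))// /M addrA lerD//.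
    apply: (le_trans (uq _)); rewrite lerD2r mulrA ler_wpM2r// ler_pdivlMr// -natrM ler_nat.
    exact: leq_trunc_div.
  have nm : (n %% m.+1 < m.+1)%N by rewrite ltn_mod.
  by rewrite (bigD1 (Ordinal nm))//= lerDl sumr_ge0.
clearbody M; near=> n.
have n0 : 0 < n%:R :> R by near: n; exact: nbhs_infty_gtr.
rewrite ler0_norm.
  rewrite opprB lerBlDl mulrC ler_pdivrMr// (le_trans (uM n))//.
  (* One half of [e] covers the excess of the block average over [inf E], the other covers
     [M / n]. *)
  rewrite [e]splitr addrA mulrDl lerD//; first by rewrite mulrC ler_wpM2r// ltW.
  rewrite mulrC -ler_pdivrMr ?divr_gt0//; near: n; exact: nbhs_infty_ger.
rewrite subr_le0; apply: ge_inf => //; exists n.-1 => //.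
by rewrite prednK// -(ltr_nat R).
Unshelve. all: by end_near. Qed.

(** * Convolution and the n-step laws *)

Section Convolution.
Context {R : realType} {G : groupType}.
Implicit Types (p q r f g h : G -> R).

Lemma psum_ge0 f : (forall s, 0 <= f s) -> (0 <= psum f)%E.
Proof. by move=> f0; apply: esum_ge0 => s _; rewrite lee_fin. Qed.

Lemma psum_le f g : (forall s, f s <= g s) -> (psum f <= psum g)%E.
Proof. by move=> fg; apply: le_esum => s _; rewrite lee_fin. Qed.

Lemma psumD f g : (forall s, 0 <= f s) -> (forall s, 0 <= g s) ->
  psum (fun s => f s + g s) = (psum f + psum g)%E.
Proof. by move=> f0 g0; rewrite /psum -esumD// => s _; rewrite lee_fin. Qed.

Lemma psumZ c f : 0 <= c -> (forall s, 0 <= f s) ->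
  psum (fun s => c * f s) = (c%:E * psum f)%E.
Proof. by move=> c0 f0; rewrite /psum -esumZl// => s; rewrite lee_fin. Qed.

Lemma prob_psumZ p c : prob_measure p -> 0 <= c ->
  psum (fun s => p s * c) = c%:E.
Proof.
move=> [p0 p1] c0; under [X in psum X]funext do rewrite mulrC.
by rewrite psumZ// p1 mule1.
Qed.

Lemma prob_le1 p s : prob_measure p -> p s <= 1.
Proof.
move=> [p0 p1]; rewrite -lee_fin -p1.
by apply: (@le_esum_term R G (fun s => (p s)%:E)) => i; rewrite lee_fin.
Qed.

Lemma econv_ge0 p q s : (forall t, 0 <= p t) -> (forall t, 0 <= q t) ->
  (0 <= econv p q s)%E.
Proof. by move=> p0 q0; apply: esum_ge0 => t _; rewrite lee_fin mulr_ge0. Qed.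

(** The sum is finite because [q <= 1] bounds it by the total mass of [p]. *)
Lemma convE p q s : prob_measure p -> prob_measure q ->
  (conv p q s)%:E = econv p q s.
Proof.
move=> pp pq; have [[p0 p1] [q0 _]] := (pp, pq).
rewrite /conv fineK// ge0_fin_numE ?econv_ge0//.
apply: (@le_lt_trans _ _ 1%E); last exact: ltry.
rewrite -p1; apply: psum_le => t.
by rewrite ler_piMr// prob_le1.
Qed.

(** Fubini together with the substitution [s = t * u]. *)
Lemma econv_psum p q f : (forall s, 0 <= p s) -> (forall s, 0 <= q s) ->
  (forall s, 0 <= f s) ->
  (\esum_(s in [set: G]) (econv p q s * (f s)%:E) =
   \esum_(t in [set: G]) \esum_(u in [set: G]) (p t * q u * f (t * u)%g)%:E)%E.
Proof.
move=> p0 q0 f0.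
transitivity (\esum_(s in [set: G]) \esum_(t in [set: G])
    (p t * q (t^-1 * s)%g * f s)%:E)%E.
  apply: eq_esum => s _; rewrite muleC -esumZl//.
    by apply: eq_esum => t _; rewrite muleC.
  by move=> t; rewrite lee_fin mulr_ge0.
rewrite esum_swap; last by move=> *; rewrite lee_fin !mulr_ge0.
apply: eq_esum => t _.
rewrite (@reindex_esum_bij R G G (fun u => t * u)%g); last first.
  exists (fun u => t^-1 * u)%g => u; [exact: mulKg|exact: mulVKg].
by apply: eq_esum => u _; rewrite mulKg.
Qed.

Lemma conv_psum p q f : prob_measure p -> prob_measure q ->
  (forall s, 0 <= f s) ->
  psum (fun s => conv p q s * f s) =
   (\esum_(t in [set: G]) \esum_(u in [set: G]) (p t * q u * f (t * u)%g)%:E)%E.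
Proof.
move=> pp pq f0; rewrite -econv_psum//; [|by case: pp|by case: pq].
by apply: eq_esum => s _; rewrite EFinM convE.
Qed.

Lemma conv_ge0 p q s : (forall t, 0 <= p t) -> (forall t, 0 <= q t) ->
  0 <= conv p q s.
Proof. by move=> p0 q0; rewrite fine_ge0// econv_ge0. Qed.

Lemma le_conv p q s t : prob_measure p -> prob_measure q ->
  p s * q t <= conv p q (s * t)%g.
Proof.
move=> pp pq; have [[p0 _] [q0 _]] := (pp, pq).
rewrite -lee_fin convE//.
have := @le_esum_term R G (fun u => (p u * q (u^-1 * (s * t))%g)%:E) s.
by rewrite mulKg; apply => u; rewrite lee_fin mulr_ge0.
Qed.

(** Common source of subadditivity for entropy and log-moments. The hypothesis carries the factor
    [p s * q t], so it constrains only pairs in the supports; since [p] and [q] have mass 1, the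
    variable absent from [g] or [h] sums out. *)
Lemma conv_psum_le p q f g h : prob_measure p -> prob_measure q ->
  (forall s, 0 <= f s) -> (forall s, 0 <= g s) -> (forall s, 0 <= h s) ->
  (forall s t, p s * q t * f (s * t)%g <= p s * q t * (g s + h t)) ->
  (psum (fun s => (conv p q s * f s)%R) <=
   psum (fun s => (p s * g s)%R) + psum (fun s => (q s * h s)%R))%E.
Proof.
move=> pp pq f0 g0 h0 fgh; have [[p0 p1] [q0 q1]] := (pp, pq).
rewrite conv_psum//.
apply: (@le_trans _ _ (\esum_(t in [set: G]) ((p t * g t)%:E +
    (p t)%:E * psum (fun s => (q s * h s)%R)))%E).
  apply: le_esum => t _.
  rewrite [X in (_ <= X + _)%E](_ : _ = psum (fun u => p t * g t * q u)); last first.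
    by rewrite psumZ ?q1 ?mule1 ?mulr_ge0.
  rewrite -psumZ//; last by move=> s; rewrite mulr_ge0.
  rewrite -psumD; [|by move=> s; rewrite !mulr_ge0|by move=> s; rewrite !mulr_ge0].
  by apply: psum_le => u; apply: (le_trans (fgh _ _)); lra.
rewrite esumD; last 2 first.
- by move=> s _; rewrite lee_fin mulr_ge0.
- by move=> s _; rewrite mule_ge0 ?lee_fin// psum_ge0// => u; rewrite mulr_ge0.
rewrite leeD2l//.
(* An infinite second term makes the bound trivial; a finite one is a real constant that can be
   averaged against [p]. *)
have [qh|qh] := eqVneq (psum (fun s => q s * h s)) +oo%E; first by rewrite qh leey.
rewrite -{2}[psum _]fineK; last first.
  by rewrite ge0_fin_numE ?ltey// psum_ge0// => s; rewrite mulr_ge0.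
rewrite -(@prob_psumZ p)//; last first.
  by rewrite fine_ge0// psum_ge0// => s; rewrite mulr_ge0.
apply: le_esum => s _; rewrite EFinM fineK//.
by rewrite ge0_fin_numE ?ltey// psum_ge0// => u; rewrite mulr_ge0.
Qed.

Lemma conv_prob p q : prob_measure p -> prob_measure q ->
  prob_measure (conv p q).
Proof.
move=> pp pq; have [[p0 p1] [q0 q1]] := (pp, pq); split.
  by move=> s; apply: conv_ge0.
rewrite -[psum _](_ : psum (fun s => conv p q s * 1) = _); last first.
  by congr psum; apply/funext => s; rewrite mulr1.
rewrite conv_psum// -p1; apply: eq_esum => t _.
rewrite -[RHS]mule1 -q1 -psumZ//; apply: eq_esum => u _.
by rewrite mulr1.
Qed.

Lemma conv_assoc p q r : prob_measure p -> prob_measure q -> prob_measure r ->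
  conv (conv p q) r = conv p (conv q r).
Proof.
move=> pp pq pr; have [[[p0 _] [q0 _]] [r0 _]] := (pp, pq, pr).
apply/funext => s; apply: EFin_inj; rewrite !convE//; [|exact: conv_prob..].
(* The function [t |-> r (t^-1 * s)] serves as test function against [conv p q]. *)
transitivity (psum (fun t => conv p q t * r (t^-1 * s)%g)) => //.
rewrite (conv_psum _ _ (fun t => r (t^-1 * s)%g))//.
apply: eq_esum => t _; rewrite EFinM convE// -esumZl//.
  by apply: eq_esum => u _; rewrite -EFinM mulrA invgM mulgA.
by move=> u; rewrite lee_fin mulr_ge0.
Qed.

Lemma convpow_prob p n : prob_measure p -> prob_measure (convpow p n).
Proof.
move=> pp; elim: n => [|n IH] /=; last exact: conv_prob.
split=> [s|]; first by case: ifP.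
by rewrite /psum (@esum_single R G _ 1%g) ?eqxx// => s /negPf ->.
Qed.

Lemma conv1l p : prob_measure p -> conv (convpow p 0) p = p.
Proof.
move=> pp; have [p0 _] := pp.
apply/funext => s; apply: EFin_inj; rewrite convE//; last exact: (convpow_prob _ 0).
rewrite /econv (@esum_single R G _ 1%g).
- by rewrite /= eqxx mul1r invg1 mul1g.
- by rewrite /= eqxx mul1r invg1 mul1g lee_fin.
- by move=> t /= /negPf ->; rewrite mul0r.
Qed.

Lemma convpow1 p : prob_measure p -> convpow p 1 = p.
Proof. exact: conv1l. Qed.

Lemma conv1r p q : prob_measure p -> prob_measure q -> conv q (convpow p 0) = q.
Proof.
move=> pp pq; have [q0 _] := pq.
apply/funext => s; apply: EFin_inj; rewrite convE//; last exact: (convpow_prob _ 0).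
rewrite /econv (@esum_single R G _ s).
- by rewrite mulVg /= eqxx mulr1.
- by rewrite mulVg /= eqxx mulr1 lee_fin.
- by move=> t ts /=; rewrite -(inj_eq (mulgI t)) mulVKg mulg1 eq_sym (negPf ts) mulr0.
Qed.

Lemma convpowD p m n : prob_measure p ->
  convpow p (m + n) = conv (convpow p m) (convpow p n).
Proof.
move=> pp; elim: n => [|n IH]; first by rewrite addn0 conv1r//; exact: convpow_prob.
by rewrite addnS /= IH conv_assoc//; exact: convpow_prob.
Qed.

(** Combined with non-degeneracy, this puts every group element in the support of some n-step law,
    which makes [mix] positive. *)
Lemma convpow_gt0 p (l : seq G) : prob_measure p -> all (fun s => 0 < p s) l ->
  0 < convpow p (size l) (\prod_(s <- l) s)%g.
Proof.
move=> pp; elim/last_ind: l => [|l x IH]; first by rewrite big_nil /= eqxx.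
rewrite all_rcons => /andP[px /IH IHl]; rewrite size_rcons big_rcons /=.
by apply: (lt_le_trans (mulr_gt0 IHl px)); apply: le_conv => //; exact: convpow_prob.
Qed.

End Convolution.

(** * Entropy, log-moments and their growth along the walk *)

Section Entropy.
Context {R : realType} {G : groupType}.
Implicit Types (p q f omega : G -> R).

Lemma prob_Nln_ge0 p s : prob_measure p -> 0 <= - ln (p s).
Proof. by move=> pp; rewrite oppr_ge0 ln_le0// prob_le1. Qed.

Lemma shannonE p : shannon p = psum (fun s => p s * - ln (p s)).
Proof. by congr psum; apply/funext => s; rewrite mulrN. Qed.

Lemma shannon_ge0 p : prob_measure p -> (0 <= shannon p)%E.
Proof.
move=> pp; rewrite shannonE psum_ge0// => s.
by rewrite mulr_ge0 ?prob_Nln_ge0//; case: pp.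
Qed.

(** By [le_conv] the convolution at [s * t] is at least [p s * q t], and [- ln] turns this into the
    pointwise bound that [conv_psum_le] requires. *)
Lemma shannon_conv p q : prob_measure p -> prob_measure q ->
  (shannon (conv p q) <= shannon p + shannon q)%E.
Proof.
move=> pp pq; have [[p0 _] [q0 _]] := (pp, pq).
rewrite !shannonE conv_psum_le// => [s|s|s|s t]; rewrite ?prob_Nln_ge0//.
  exact: conv_prob.
(* As [ln 0 = 0], the inequality of logarithms may fail off the supports, but there the factor
   [p s * q t] vanishes. *)
have [->|/eqP ps] := eqVneq (p s) 0; first by rewrite !mul0r.
have [->|/eqP qt] := eqVneq (q t) 0; first by rewrite mulr0 !mul0r.
have ps0 : 0 < p s by rewrite lt_neqAle p0 andbT eq_sym; apply/eqP.
have qt0 : 0 < q t by rewrite lt_neqAle q0 andbT eq_sym; apply/eqP.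
have pq0 := mulr_gt0 ps0 qt0.
rewrite ler_pM2l// -opprD lerN2 -lnM ?posrE//.
by rewrite ler_ln ?posrE ?le_conv// (lt_le_trans pq0)// le_conv.
Qed.

Lemma shannon_convpow0 p : shannon (convpow p 0) = 0%E.
Proof.
by apply: esum1 => s _ /=; case: eqP => _; rewrite ?ln1 ?mul0r ?mulr0 oppr0.
Qed.

Lemma shannon_convpow_fin p n : prob_measure p -> (shannon p < +oo)%E ->
  shannon (convpow p n) \is a fin_num.
Proof.
move=> pp sp; rewrite ge0_fin_numE; last exact/shannon_ge0/convpow_prob.
elim: n => [|n IH]; first by rewrite shannon_convpow0.
by apply: le_lt_trans (lte_add_pinfty IH sp); apply: shannon_conv => //; exact: convpow_prob.
Qed.

Lemma avez_cvg p : prob_measure p -> (shannon p < +oo)%E ->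
  exists h : R, (fun n => n%:R^-1 * fine (shannon (convpow p n))) @ \oo --> h.
Proof.
move=> pp sp; apply/cvg_ex; apply: fekete => [n|m n].
  by rewrite fine_ge0//; exact/shannon_ge0/convpow_prob.
have F k := @shannon_convpow_fin p k pp sp.
rewrite -fineD// fine_le ?fin_numD ?F//.
by rewrite convpowD//; apply: shannon_conv; exact: convpow_prob.
Qed.

(* Gibbs' inequality, up to the value of the additive constant. *)
Lemma entropy_term_le (x w : R) : 0 <= x -> 0 < w -> - (x * ln x) <= x * ln w + w^-1.
Proof.
rewrite le_eqVlt => /predU1P[<- w0|x0 w0].
  by rewrite !mul0r oppr0 add0r invr_ge0 ltW.
have xw := mulr_gt0 x0 w0.
have : ln (x * w)^-1 <= (x * w)^-1.
  by apply/ltW/ln_sublinear; rewrite invr_gt0.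
rewrite lnV ?posrE// lnM ?posrE// -(ler_pM2l x0) invfM mulrA divff ?gt_eqF// mul1r.
lra.
Qed.

(** The lower bound [- b] on [ln omega] keeps the negative part of the moment below [b], so the
    signed sum becomes a sum of nonnegative terms minus a finite constant. *)
Lemma log_momentE p omega b : prob_measure p -> 0 <= b ->
  (forall s, 0 <= ln (omega s) + b) ->
  log_moment p omega = (psum (fun s => (p s * (ln (omega s) + b))%R) - b%:E)%E.
Proof.
move=> pp b0 wb; have [p0 p1] := pp; rewrite /log_moment /gsum.
set P := (X in (X - _)%E); set N := (X in (_ - X)%E).
have N0 : (0 <= N)%E by apply: esum_ge0 => s _; rewrite lee_fin le_max lexx orbT.
have Nb : (N <= b%:E)%E.
  rewrite -(@prob_psumZ _ _ p)//; apply: psum_le => s.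
  rewrite ge_max mulr_ge0// andbT -mulrN ler_wpM2l//.
  by have := wb s; lra.
have Nfin : N \is a fin_num by rewrite ge0_fin_numE// (le_lt_trans Nb) ?ltry.
(* The identity is stated with additions only, since [P] may be infinite; [b] and [N] are finite and
   are cancelled afterwards. *)
have : (P + b%:E = psum (fun s => (p s * (ln (omega s) + b))%R) + N)%E.
  rewrite -(@prob_psumZ _ _ p)// -esumD; last 2 first.
  - by move=> s _; rewrite lee_fin le_max lexx orbT.
  - by move=> s _; rewrite lee_fin mulr_ge0.
  rewrite -esumD; last 2 first.
  - by move=> s _; rewrite lee_fin mulr_ge0.
  - by move=> s _; rewrite lee_fin le_max lexx orbT.
  apply: eq_esum => s _; rewrite -!EFinD; congr EFin.
  by case: (lerP (p s * ln (omega s)) 0) => h1; case: (lerP (- (p s * ln (omega s))) 0) => h2; lra.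
move=> PbE; have -> : P = (psum (fun s => (p s * (ln (omega s) + b))%R) + N - b%:E)%E.
  by rewrite -PbE addeK.
by rewrite addeAC addeK.
Qed.

(** [b] compensates the lower bound of the weight and [K] its constant [C]. [K] is grouped with the
    first summand to match the shape [g s + h t] of [conv_psum_le]. *)
Lemma weight_shift omega : weight omega -> exists b K : R,
  [/\ 0 <= b, 0 <= K, (forall s, 0 <= ln (omega s) + b), (forall s, 0 < omega s)
    & forall s t, ln (omega (s * t)%g) + b <= (ln (omega s) + b + K) + (ln (omega t) + b)].
Proof.
move=> [[a [a0 aw]] [C [C0 Cw]]].
have w0 s : 0 < omega s by apply: lt_le_trans (aw s).
exists `|ln a|, `|ln C|; split => // [s|s t].
  have : ln a <= ln (omega s) by rewrite ler_ln ?posrE.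
  by have := ler_norm (- ln a); rewrite normrN; lra.
have : ln (omega (s * t)%g) <= ln C + ln (omega s) + ln (omega t).
  by rewrite -!lnM ?posrE ?mulr_gt0// ler_ln ?posrE ?mulr_gt0.
by have := ler_norm (ln C); have := normr_ge0 (ln a); lra.
Qed.

(** Log-moments may be negative and are subadditive only up to a constant, so Fekete's lemma is
    applied to a shifted sequence; the shift is lost after division by [n]. *)
Lemma log_moment_cvg p omega : prob_measure p -> Omega p omega ->
  (forall n, log_moment (convpow p n) omega \is a fin_num) /\
  cvgn (fun n => n%:R^-1 * fine (log_moment (convpow p n) omega)).
Proof.
move=> pp [ww lw _].
have [b [K [b0 K0 wb w0 wD]]] := weight_shift _ ww.
have pn n := convpow_prob p n pp.
pose f s := ln (omega s) + b.
pose S n := psum (fun s => (convpow p n s * f s)%R).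
have lmE n : log_moment (convpow p n) omega = (S n - b%:E)%E by exact: log_momentE.
have S0 n : (0 <= S n)%E.
  by apply: psum_ge0 => s; rewrite mulr_ge0 ?wb//; case: (pn n).
have SD m n : (S (m + n)%N <= S m + S n + K%:E)%E.
  rewrite [X in (_ <= X)%E]addeAC /S convpowD//.
  apply: (le_trans (conv_psum_le _ _ f (fun s => f s + K) f _ _ _ _ _ _)) => //.
  - by move=> s; rewrite addr_ge0 ?wb.
  - move=> s t; rewrite ler_wpM2l ?wD// mulr_ge0//; [by case: (pn m)|by case: (pn n)].
  rewrite leeD2r// -(@prob_psumZ _ _ (convpow p m))// -psumD.
  - by apply: psum_le => s; rewrite mulrDr.
  - by move=> s; rewrite mulr_ge0 ?wb//; case: (pn m).
  - by move=> s; rewrite mulr_ge0//; case: (pn m).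
have S1 : (S 1%N < +oo)%E.
  by move: lw; rewrite -{1}(convpow1 p pp) lmE; case: (S 1%N) => [r||]//=; rewrite ?ltry// addye//.
have Sfin n : S n \is a fin_num.
  rewrite ge0_fin_numE//; elim: n => [|n IH].
    rewrite /S /psum (@esum_single R G _ 1%g) /= ?eqxx ?ltry// ?lee_fin ?mul1r ?wb//.
    by move=> s /negPf ->; rewrite mul0r.
  rewrite -addn1 (le_lt_trans (SD _ _))//.
  exact: lte_add_pinfty (lte_add_pinfty IH S1) (ltry _).
split => [n|]; first by rewrite lmE fin_numB Sfin.
(* Adding [K] absorbs the defect in [SD]: [S (m + n) + K <= (S m + K) + (S n + K)]. *)
have c1 : cvgn (fun n => n%:R^-1 * (fine (S n) + K)).
  apply: fekete => [n|m n]; first by rewrite addr_ge0// fine_ge0.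
  rewrite addrACA addrA lerD2r -lee_fin !EFinD !fineK//.
rewrite (_ : (fun n => _) =
   (fun n => n%:R^-1 * (fine (S n) + K)) \- (fun n => n%:R^-1 * (K + b)))//; last first.
  by apply/funext => n /=; rewrite lmE fineB//=; ring.
apply: is_cvgB => //; apply: is_cvgMl.
apply/cvg_ex; exists 0; rewrite -cvg_shiftS; exact: cvg_harmonic.
Qed.

Lemma shannon_le_log_moment p omega : prob_measure p -> weight omega ->
  (shannon p <= log_moment p omega + psum (fun s => ((omega s)^-1)%R))%E.
Proof.
move=> pp ww; have [p0 p1] := pp.
have [b [K [b0 K0 wb w0 wD]]] := weight_shift _ ww.
(* Moving [b] to the left leaves only nonnegative series, compared term by term through
   [entropy_term_le]. *)
rewrite (log_momentE _ _ b)// addeAC leeBrDr//.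
rewrite -(@prob_psumZ _ _ p)// -!psumD//.
- apply: psum_le => s; have := entropy_term_le _ _ (p0 s) (w0 s); lra.
- by move=> s; rewrite mulr_ge0 ?wb.
- by move=> s; rewrite invr_ge0 ltW.
- by move=> s; rewrite -mulrN mulr_ge0// prob_Nln_ge0.
- by move=> s; rewrite mulr_ge0.
Qed.

End Entropy.

(** * The mixing coefficients *)

Section Coefficients.
Context {R : realType}.

(** The term telescopes as [1 / (n + 1) - 1 / (n + 2)]. Its decay is only polynomial, which keeps
    [- ln (coef n)] sublinear; geometric coefficients would leave a positive constant in the bound
    on the Lyapunov exponent. *)
Definition coef (n : nat) : R := (n.+1%:R * n.+2%:R)^-1.

Lemma coef_gt0 n : 0 < coef n.
Proof. by rewrite invr_gt0 mulr_gt0. Qed.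

Lemma coef_ge0 n : 0 <= coef n.
Proof. exact/ltW/coef_gt0. Qed.

Lemma Nln_coef_ge0 n : 0 <= - ln (coef n).
Proof.
rewrite oppr_ge0 ln_le0// /coef invf_le1 ?mulr_gt0//.
by rewrite -natrM ler1n.
Qed.

Lemma esum_coef_le1 : (\esum_(n in [set: nat]) (coef n)%:E <= 1)%E.
Proof.
rewrite -nneseries_esumT => [|n]; last by rewrite lee_fin coef_ge0.
have sumE n : \sum_(0 <= i < n) coef i = 1 - n.+1%:R^-1 :> R.
  elim: n => [|n IH]; first by rewrite big_geq// invr1 subrr.
  rewrite big_nat_recr//= {}IH /coef.
  have := ltr0Sn R n; have := ltr0Sn R n.+1; rewrite -!natr1 => n1 n2.
  by field; rewrite !gt_eqF.
apply: lime_le.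
  by apply: is_cvg_ereal_nneg_natsum => n _; rewrite lee_fin coef_ge0.
by near=> n; rewrite sumEFin lee_fin sumE gerBl.
Unshelve. all: by end_near. Qed.

(** With [a], [b], [d] the inverses of the three coefficients, this is [d <= 2 * (a + b)] divided by
    [a * b * d]. *)
Lemma coefM_le m n : coef m * coef n <= 2 * (coef m + coef n) * coef (m + n).
Proof.
rewrite /coef -[m.+2%:R]natr1 -[m.+1%:R]natr1 -[n.+2%:R]natr1 -[n.+1%:R]natr1.
rewrite -[(m + n).+2%:R]natr1 -[(m + n).+1%:R]natr1 natrD.
have : 0 <= m%:R :> R by []. have : 0 <= n%:R :> R by [].
move: (m%:R : R) (n%:R : R) => x y y0 x0.
set a := (x + 1) * (x + 1 + 1); set b := (y + 1) * (y + 1 + 1).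
set d := (x + y + 1) * _.
have a0 : 0 < a by rewrite mulr_gt0//; lra.
have b0 : 0 < b by rewrite mulr_gt0//; lra.
have d0 : 0 < d by rewrite mulr_gt0//; lra.
(* The gap is [(x - y)^2 + 3 * (x + y) + 6]. *)
have dab : d <= 2 * (a + b) by rewrite /d /a /b; have := sqr_ge0 (x - y); lra.
rewrite (_ : 2 * _ * _ = (a^-1 * b^-1) * (2 * (a + b) / d)).
  by rewrite ler_peMr ?mulr_ge0 ?invr_ge0 ?(ltW a0) ?(ltW b0)// ler_pdivlMr// mul1r.
by field; rewrite ?gt_eqF//.
Qed.

(** The inverse coefficient is at most [16 * k^2 = (2 * r)^4] with [r] the square root of [k], and
    [ln y <= y] at [y = 2 * r] gives [8 * r], written as [k] times a null sequence. *)
Lemma ln_coef_le n : - ln (coef n.+1) <= n.+1%:R * (8 * Num.sqrt (n.+1%:R^-1)).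
Proof.
set k : R := n.+1%:R.
have k1 : 1 <= k by rewrite /k ler1n.
have k0 : 0 < k by lra.
pose r := Num.sqrt k.
have r0 : 0 < r by rewrite sqrtr_gt0.
have rr : k = r ^+ 2 by rewrite sqr_sqrtr// ltW.
have -> : Num.sqrt k^-1 = r^-1 by rewrite sqrtrV// ltW.
rewrite /coef lnV ?posrE ?mulr_gt0// opprK.
apply: (@le_trans _ _ (ln ((2 * r) ^+ 4))).
  rewrite ler_ln ?posrE ?mulr_gt0 ?exprn_gt0 ?mulr_gt0//.
  rewrite -[n.+3%:R]natr1 -[n.+2%:R]natr1 -/k.
  have -> : (2 * r) ^+ 4 = 16 * k * k by rewrite rr; ring.
  nra.
rewrite lnXn ?mulr_gt0// -[leLHS]mulr_natl.
have -> : k * (8 / r) = 4 * (2 * r) by rewrite rr; field; rewrite gt_eqF.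
by rewrite ler_pM2l// ltW// ln_sublinear// mulr_gt0.
Qed.

Lemma ln_coef_cvg0 : (fun n => n%:R^-1 * - ln (coef n)) @ \oo --> (0 : R).
Proof.
rewrite -cvg_shiftS /=.
apply: (@squeeze_cvgr _ _ _ _ (fun=> 0) (fun n => 8 * Num.sqrt (n.+1%:R^-1))).
- near=> n; apply/andP; split; first by rewrite mulr_ge0// Nln_coef_ge0.
  by rewrite ler_pdivrMl// ln_coef_le.
- exact: cvg_cst.
- have sqrt0 : (fun n => Num.sqrt (n.+1%:R^-1 : R)) @ \oo --> (0 : R).
    by have := cvg_comp _ _ (@cvg_harmonic R) (@sqrt_continuous R 0); rewrite sqrtr0.
  by have := cvgM (cvg_cst (8 : R)) sqrt0; rewrite mulr0; apply.
Unshelve. all: by end_near. Qed.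

End Coefficients.

(** * The mixture of the n-step laws and its inverse *)

Section OptimalWeight.
Context {R : realType} {G : groupType}.
Variable mu : G -> R.
Hypotheses (hmu : prob_measure mu) (hnd : non_degenerate mu)
  (hH : (shannon mu < +oo)%E).

Let mun_prob n := convpow_prob mu n hmu.

Let mun_ge0 n s : 0 <= convpow mu n s.
Proof. by case: (mun_prob n). Qed.

(** The law of the walk at an independent random time distributed as [coef], time 0 included. *)
Definition emix (s : G) : \bar R :=
  \esum_(n in [set: nat]) (coef n * convpow mu n s)%:E.

Definition mix (s : G) : R := fine (emix s).

Let term_ge0 n s : (0 <= (coef n * convpow mu n s)%:E)%E.
Proof. by rewrite lee_fin mulr_ge0 ?coef_ge0. Qed.

Lemma emix_le1 s : (emix s <= 1)%E.
Proof.
apply: le_trans (@esum_coef_le1 R); apply: le_esum => n _.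
by rewrite lee_fin ler_piMr ?coef_ge0// prob_le1.
Qed.

Lemma mixE s : (mix s)%:E = emix s.
Proof.
rewrite fineK// ge0_fin_numE ?(le_lt_trans (emix_le1 s)) ?ltry//.
by apply: esum_ge0 => n _; exact: term_ge0.
Qed.

Lemma mix_le1 s : mix s <= 1.
Proof. by rewrite -lee_fin mixE emix_le1. Qed.

Lemma le_mix n s : coef n * convpow mu n s <= mix s.
Proof.
rewrite -lee_fin mixE.
exact: (@le_esum_term R nat (fun n => (coef n * convpow mu n s)%:E)).
Qed.

Lemma mix_gt0 s : 0 < mix s.
Proof.
have [l [_ l0 ->]] := hnd s.
by apply: lt_le_trans (le_mix (size l) _); rewrite mulr_gt0 ?coef_gt0 ?convpow_gt0.
Qed.

Lemma psum_mix_le1 : (psum mix <= 1)%E.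
Proof.
apply: le_trans (@esum_coef_le1 R).
rewrite /psum; under eq_esum do rewrite mixE.
rewrite esum_swap => [|s n]; last exact: term_ge0.
apply: le_esum => n _.
rewrite -[X in (_ <= X)%E]mule1 -(proj2 (mun_prob n)) -psumZ ?coef_ge0//.
Qed.

(** The convolution is the double series of [coef m * coef n * convpow mu (m + n) s]. [coefM_le]
    splits it into two symmetric halves, each at most [2 * mix s]. *)
Lemma econv_mix s : (econv mix mix s <= (4 * mix s)%:E)%E.
Proof.
have -> : econv mix mix s = (\esum_(m in [set: nat]) \esum_(n in [set: nat])
    (coef m * coef n * convpow mu (m + n) s)%:E)%E.
  transitivity (\esum_(t in [set: G]) \esum_(m in [set: nat]) \esum_(n in [set: nat])
    (coef m * convpow mu m t * (coef n * convpow mu n (t^-1 * s)%g))%:E)%E.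
    apply: eq_esum => t _; apply: esum_prod; rewrite ?mixE// => n;
    by rewrite mulr_ge0 ?coef_ge0.
  have ccu0 m n t u :
      (0 <= (coef m * convpow mu m t * (coef n * convpow mu n u))%:E)%E.
    by rewrite lee_fin !mulr_ge0 ?coef_ge0.
  rewrite esum_swap => [|t m]; last by apply: esum_ge0 => n _; exact: ccu0.
  apply: eq_esum => m _; rewrite esum_swap => [|t n]; last exact: ccu0.
  apply: eq_esum => n _; rewrite EFinM convpowD// convE// -esumZl.
  - by apply: eq_esum => t _; rewrite -EFinM; congr EFin; ring.
  - by rewrite mulr_ge0 ?coef_ge0.
  - by move=> t; rewrite lee_fin mulr_ge0.
(* For fixed [m] the indices [m + n] are distinct, so this is a subseries of [mix s]. *)
have tail m : (\esum_(n in [set: nat]) (coef (m + n) * convpow mu (m + n) s)%:E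
    <= (mix s)%:E)%E.
  rewrite mixE.
  apply: (@le_esum_inj R nat nat (addn m) (fun n => (coef n * convpow mu n s)%:E)) => //.
  exact: addnI.
have ms0 : 0 <= mix s by exact/ltW/mix_gt0.
pose a m n : R := 2 * coef m * (coef (m + n) * convpow mu (m + n) s).
have a0 m n : (0 <= (a m n)%:E)%E by rewrite lee_fin !mulr_ge0 ?coef_ge0.
have half : (\esum_(m in [set: nat]) \esum_(n in [set: nat]) (a m n)%:E
    <= (2 * mix s)%:E)%E.
  rewrite -[leRHS]mule1.
  apply: (@le_trans _ _ (\esum_(m in [set: nat]) ((2 * mix s)%:E * (coef m)%:E))%E).
    apply: le_esum => m _; under eq_esum do rewrite EFinM.
    rewrite esumZl ?mulr_ge0 ?coef_ge0//.
    rewrite -EFinM mulrAC [leRHS]EFinM lee_wpmul2l// lee_fin mulr_ge0 ?coef_ge0//.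
  rewrite esumZl ?mulr_ge0// => [|m]; last by rewrite lee_fin coef_ge0.
  by rewrite lee_wpmul2l ?esum_coef_le1// lee_fin mulr_ge0.
apply: (@le_trans _ _ (\esum_(m in [set: nat]) \esum_(n in [set: nat])
    ((a m n)%:E + (a n m)%:E))%E).
  apply: le_esum => m _; apply: le_esum => n _; rewrite -EFinD lee_fin /a.
  rewrite [(n + m)%N]addnC.
  have := ler_wpM2r (mun_ge0 (m + n) s) (coefM_le m n); lra.
rewrite (_ : 4 * mix s = 2 * mix s + 2 * mix s); last by lra.
rewrite EFinD; under eq_esum do rewrite esumD//.
rewrite esumD; [|by move=> m _; exact: esum_ge0..].
by rewrite leeD// esum_swap.
Qed.

Definition opt_weight (s : G) : R := (mix s)^-1.

Lemma opt_weight_ge1 s : 1 <= opt_weight s.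
Proof. by rewrite invf_ge1 ?mix_le1 ?mix_gt0. Qed.

Lemma opt_weightV : (fun s => (opt_weight s)^-1) = mix.
Proof. by apply/funext => s; rewrite invrK. Qed.

Lemma weight_opt_weight : weight opt_weight.
Proof.
split; first by exists 1; split => // s; exact: opt_weight_ge1.
exists 4; split=> // s t.
have st : mix s * mix t <= 4 * mix (s * t)%g.
  rewrite -lee_fin; apply: le_trans (econv_mix (s * t)%g).
  have := @le_esum_term R G (fun u => (mix u * mix (u^-1 * (s * t))%g)%:E) s.
  by rewrite mulKg; apply => u; rewrite lee_fin mulr_ge0// ltW// mix_gt0.
have [[s0 t0] st0] := (mix_gt0 s, mix_gt0 t, mix_gt0 (s * t)%g).
rewrite /opt_weight -mulrA -invfM ler_pdivlMr ?mulr_gt0//.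
by rewrite mulrC ler_pdivrMr.
Qed.

Lemma log_moment_opt_weight n :
  (log_moment (convpow mu n) opt_weight
     <= shannon (convpow mu n) + (- ln (coef n))%:E)%E.
Proof.
have ln0 s : 0 <= ln (opt_weight s) by rewrite ln_ge0// opt_weight_ge1.
have c0 := @Nln_coef_ge0 R n.
rewrite (log_momentE _ _ 0)// => [|s]; last by rewrite addr0.
rewrite sube0 shannonE -(@prob_psumZ _ _ (convpow mu n))// -psumD; last 2 first.
- by move=> s; rewrite mulr_ge0// prob_Nln_ge0.
- by move=> s; rewrite mulr_ge0.
apply: psum_le => s; rewrite addr0 -mulrDr.
have := mun_ge0 n s; rewrite le_eqVlt => /predU1P[<-|p0]; first by rewrite !mul0r.
rewrite ler_pM2l// /opt_weight lnV ?posrE ?mix_gt0// -opprD lerN2.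
rewrite addrC -lnM ?posrE ?coef_gt0// ler_ln ?posrE ?mix_gt0 ?mulr_gt0 ?coef_gt0//.
exact: le_mix.
Qed.

(** The moment condition is the case [n = 1] of [log_moment_opt_weight], where [hH] makes the bound
    finite. *)
Lemma Omega_opt_weight : Omega mu opt_weight.
Proof.
split; first exact: weight_opt_weight.
  rewrite -(convpow1 mu hmu); apply: (le_lt_trans (log_moment_opt_weight 1)).
  by rewrite convpow1// lte_add_pinfty// ltry.
by rewrite opt_weightV (le_lt_trans psum_mix_le1)// ltry.
Qed.

End OptimalWeight.

(** * Comparison of the Avez entropy with Lyapunov exponents *)

Lemma cvg_normalized (R : realType) (u : nat -> \bar R) (l : R) :
  (forall n, u n \is a fin_num) -> (fun n => n%:R^-1 * fine (u n)) @ \oo --> l ->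
  ((n%:R^-1)%:E * u n)%E @[n --> \oo] --> l%:E.
Proof.
move=> ufin ul.
rewrite (_ : (fun n => _) = EFin \o (fun n => n%:R^-1 * fine (u n))).
  by apply: cvg_EFin; [exact: nearW|exact: ul].
by apply/funext => n /=; rewrite EFinM fineK.
Qed.

Theorem theorem4p7 (R : realType) (G : groupType) (mu : G -> R)
  (hG : countable [set: G])
  (hmu : prob_measure mu) (hnd : non_degenerate mu)
  (hH : (shannon mu < +oo)%E) :
  (exists h : R, avez_seq mu @ \oo --> h%:E) /\
  avez mu = ereal_inf [set lyap mu omega | omega in Omega mu] /\
  exists omegab : G -> R,
    [/\ Omega mu omegab,
        (exists d : R, 0 < d /\
           forall s : G, (econv (fun t => ((omegab t)^-1)%R) (fun t => ((omegab t)^-1)%R) s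
                          <= (d * (omegab s)^-1)%R%:E)%E),
        lyap mu omegab = ereal_inf [set lyap mu omega | omega in Omega mu]
      & avez mu = lyap mu omegab].
Proof.
have [h hcvg] := avez_cvg mu hmu hH.
have mun n := convpow_prob mu n hmu.
have Hfin n := shannon_convpow_fin mu n hmu hH.
have acvg : avez_seq mu @ \oo --> h%:E by exact: cvg_normalized.
have avezE : avez mu = h%:E by exact: cvg_lim.
have inv0 : (fun n => n%:R^-1 : R) @ \oo --> (0 : R).
  by rewrite -cvg_shiftS; exact: cvg_harmonic.
(* [Z] is the l^1-norm of [1 / omega]; it does not depend on [n], so it disappears in the limit. *)
have gibbs omega : Omega mu omega -> exists2 Z : R, 0 <= Z & forall n,
    n%:R^-1 * fine (shannon (convpow mu n)) - n%:R^-1 * Z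
      <= n%:R^-1 * fine (log_moment (convpow mu n) omega).
  move=> Ow; have [lfin _] := log_moment_cvg mu omega hmu Ow.
  have [ww _ Zoo] := Ow.
  have [b [K [_ _ _ w0 _]]] := weight_shift _ ww.
  have Z0 : (0 <= psum (fun s => ((omega s)^-1)%R))%E.
    by apply: psum_ge0 => s; rewrite invr_ge0 ltW.
  exists (fine (psum (fun s => ((omega s)^-1)%R))); first exact: fine_ge0.
  move=> n; rewrite -mulrBr ler_wpM2l// lerBlDr -lee_fin EFinD !fineK//.
    exact: shannon_le_log_moment.
  by rewrite ge0_fin_numE.
have HZcvg (Z : R) : (fun n => n%:R^-1 * fine (shannon (convpow mu n)) -
    n%:R^-1 * Z) @ \oo --> h.
  by have := cvgB hcvg (cvgM inv0 (cvg_cst Z)); rewrite mul0r subr0; exact.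
have lower omega : Omega mu omega -> (h%:E <= lyap mu omega)%E.
  move=> Ow; have [Z Z0 HZ] := gibbs _ Ow.
  have [lfin /cvg_ex[l lcvg]] := log_moment_cvg mu omega hmu Ow.
  rewrite (_ : lyap mu omega = l%:E); last exact/cvg_lim/cvg_normalized.
  rewrite lee_fin.
  rewrite -(cvg_lim _ (HZcvg Z))// -(cvg_lim _ lcvg)//.
  apply: ler_lim; [exact: cvgP (HZcvg Z)|exact: cvgP lcvg|].
  by near=> n; exact: HZ.
have Ob := Omega_opt_weight mu hmu hnd hH.
have lyapE : lyap mu (opt_weight mu) = h%:E.
  have [Z Z0 HZ] := gibbs _ Ob.
  have [lfin _] := log_moment_cvg mu _ hmu Ob.
  apply/cvg_lim/cvg_normalized => //.
  have Hccvg : (fun n => n%:R^-1 * fine (shannon (convpow mu n)) +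
      n%:R^-1 * - ln (coef n)) @ \oo --> h.
    by have := cvgD hcvg (@ln_coef_cvg0 R); rewrite addr0; exact.
  (* Both bounds tend to [h]: the lower one is [gibbs] for this weight, the upper one costs only
     [- ln (coef n) / n]. *)
  apply: squeeze_cvgr (HZcvg Z) Hccvg; near=> n; apply/andP; split; first exact: HZ.
  rewrite /= -mulrDr ler_wpM2l// -lee_fin EFinD !fineK//.
  exact: log_moment_opt_weight.
have infE : ereal_inf [set lyap mu omega | omega in Omega mu] = h%:E.
  apply/eqP; rewrite eq_le; apply/andP; split.
    by apply: ereal_inf_lbound; exists (opt_weight mu).
  by apply: le_ereal_inf_tmp => _ [omega Ow <-]; exact: lower.
rewrite avezE infE; split; first by exists h.
split=> //; exists (opt_weight mu); split => //.
exists 4; split => // s; rewrite opt_weightV /opt_weight invrK.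
exact: econv_mix.
Unshelve. all: by end_near. Qed.
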